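(* Let $M_3=\Gamma\backslash H(2,1)\times S^1$ be the compact nilmanifold with invariant coframe $f^1,\dots,f^6$ satisfying $df^1=\dots=df^5=0$, $df^6=-2f^{12}+2f^{34}$, and for $t\in\mathbb{R}\setminus\{0\}$ let $(J_t,g_t)$ be the balanced Hermitian structure on $M_3$ described in the context, with torsion $T$, Levi-Civita connection $\nabla^g_t$ and Bismut-Strominger connection $\nabla^+_t$. For nonzero real $t'\neq t$ consider the connection $A=\nabla^+_{t'}$ on $TM_3$ associated with $(J_{t'},g_{t'})$, which is an $SU(3)$-instanton with respect to $(J_t,g_t)$. Then, for the structure $(J_t,g_t)$: (a) $dT=\dfrac{8\pi^2t^2}{3t^4-8t'^4}\,\big(p_1(\nabla^g_t)-p_1(\nabla^+_{t'})\big)$ whenever $3t^4\neq 8t'^4$; (b) $dT=\dfrac{\pi^2t^2}{t^4-t'^4}\,\big(p_1(\nabla^+_t)-p_1(\nabla^+_{t'})\big)$ whenever $t^4\neq t'^4$. Hence, for every pair $(t,t')$ with $8t'^4<3t^4$, $(M_3,J_t,g_t,A=\nabla^+_{t'})$ is a solution to the heterotic supersymmetry equations with non-zero flux $H=T$ and constant dilaton which satisfies the three-form Bianchi identity with some $\alpha'>0$, both for $R$ the curvature of the Levi-Civita connection $\nabla^g_t$ and for $R$ the curvature of the $(+)$-connection $\nabla^+_t$. Moreover, the compact manifold $(M_3,g_t,J_t,A=\nabla^+_{t'},R=R(\nabla^+_t))$ of (b) solves the heterotic equations of motion (with the same $\alpha'$ as in the Bianchi identity).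
   Context: Notation: $f^{ij}=f^i\wedge f^j$, etc. $H(2,1)$ is the $5$-dimensional generalized Heisenberg group, $\Gamma$ a lattice in it; $H(2,1)\times\mathbb{R}$ has Lie algebra $\mathfrak{h}_3$ with a left invariant coframe $f^1,\dots,f^6$ with the structure equations stated in the claim, descending to $M_3$. The structure $(J_t,g_t)$: put $e^i=f^i$ ($1\le i\le5$), $e^6=t\,f^6$, with dual frame $E_1,\dots,E_6$. Then $g_t=\sum_i e^i\otimes e^i$, and $J_t$ acts on vectors by $JE_2=E_1$, $JE_1=-E_2$, $JE_4=E_3$, $JE_3=-E_4$, $JE_6=E_5$, $JE_5=-E_6$ (equivalently, with $(Je)(X)=-e(JX)$, $Je^1=-e^2$, $Je^3=-e^4$, $Je^5=-e^6$). The Kaehler form $F(X,Y)=g(X,JY)$ is $F=e^{12}+e^{34}+e^{56}$. For a Hermitian structure $(J,g)$: $T(X,Y,Z)=-dF(JX,JY,JZ)$; $\nabla^g$ is the Levi-Civita connection; $\nabla^+$ is defined by $g(\nabla^+_XY,Z)=g(\nabla^g_XY,Z)+\frac12T(X,Y,Z)$. Balanced means $\theta=0$, where $\theta(X)=(\delta F)(JX)$; equivalently $d*F=0$. Pontrjagin forms: for a metric connection with curvature $2$-forms $\Omega^i_j(X,Y)=g(R(X,Y)E_j,E_i)$ in an orthonormal frame, $p_1=\frac1{8\pi^2}\sum_{i<j}\Omega^i_j\wedge\Omega^i_j$. For $\nabla^+_{t'}$ the bundle metric on $TM_3$ is $g_{t'}$. An $SU(3)$-instanton with respect to $(J,g)$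 is a connection whose curvature $\Omega$ satisfies $\Omega(JX,JY)=\Omega(X,Y)$ and $\sum_{k=1}^6\Omega(E_k,JE_k)=0$ for a $g$-orthonormal frame. Heterotic supersymmetry equations with constant dilaton for $(M,J,g,A)$: (i) $Hol(\nabla^+)\subset\mathfrak{su}(3)$, i.e. $\sum_i g(R^+(X,Y)JE_i,E_i)=0$; (ii) $(J,g)$ is balanced; (iii) $A$ is an $SU(3)$-instanton. Three-form Bianchi identity: $dT=\frac{\alpha'}4\big(Tr(R\wedge R)-Tr(F^A\wedge F^A)\big)$, where $Tr(R\wedge R)=\sum_{a,b}R_{ab}\wedge R_{ab}$ over all pairs of matrix indices in an orthonormal frame (and similarly for the curvature $F^A$ of $A$); with $p_1=\frac1{8\pi^2}\sum_{i<j}\Omega^i_j\wedge\Omega^i_j$, $Tr(R\wedge R)=16\pi^2p_1(R)$. Heterotic equations of motion with constant dilaton and $H=T$ (indices in $g$-orthonormal frames, matrix indices $a,b$ in an orthonormal frame of the corresponding bundle, $R_{imab}=g(R(E_i,E_m)E_a,E_b)$): $Ric^g_{ij}-\frac14H_{imn}H_j{}^{mn}-\frac{\alpha'}4\big[(F^A)_{imab}(F^A)_j{}^{mab}-R_{imab}R_j{}^{mab}\big]=0$; $\nabla^g_iH^i{}_{jk}=0$; $\nabla^+_i(F^A)^i{}_j=0$ (with $\nabla^+$ coupled to $A$). *)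

(* Defs.v *)
From HB Require Import structures.
From mathcomp Require Import all_boot all_order all_algebra.
From mathcomp Require Import generic_quotient ring.
From mathcomp Require Import all_classical all_reals all_analysis.

Set Implicit Arguments.
Unset Strict Implicit.
Unset Printing Implicit Defensive.

Import Order.TTheory GRing.Theory Num.Theory.
Import numFieldNormedType.Exports.

Local Open Scope classical_set_scope.
Local Open Scope ring_scope.
Local Open Scope quotient_scope.

(* H(2,1) is the group of the 4 x 4 matrices
     [ 1 a c ; 0 I_2 b ; 0 0 1 ]
   with a a row of length 2, b a column of length 2 and c a number; such a
   matrix is recorded as the triple (a, b, c). *)
Notation H21 R := ('rV[R]_2 * 'cV[R]_2 * R)%type.

Section Heisenberg.
Variable R : realType.
Implicit Types x y : H21 R.

Definition hmul x y : H21 R :=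
  (x.1.1 + y.1.1, x.1.2 + y.1.2, x.2 + y.2 + (x.1.1 *m y.1.2) 0 0).

Definition hone : H21 R := 0.

Definition hinv x : H21 R := (- x.1.1, - x.1.2, - x.2 + (x.1.1 *m x.1.2) 0 0).

Lemma hmulA x y z : hmul x (hmul y z) = hmul (hmul x y) z.
Proof.
rewrite /hmul /=; congr (_, _, _); rewrite ?addrA // mulmxDl mulmxDr !mxE.
by ring.
Qed.

Lemma hmul1x x : hmul hone x = x.
Proof. by case: x => [[a b] c]; rewrite /hmul /= mul0mx mxE !add0r addr0. Qed.

Lemma hmulVx x : hmul (hinv x) x = hone.
Proof.
case: x => [[a b] c]; rewrite /hmul /= mulNmx !mxE !addNr /hone.
congr (_, _, _). by ring.
Qed.

Record lattice := Lattice {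
  lat : set (H21 R);
  lat_one : lat hone;
  lat_mul : forall x y, lat x -> lat y -> lat (hmul x y);
  lat_inv : forall x, lat x -> lat (hinv x);
  lat_discrete : exists2 U, nbhs hone U & U `&` lat = [set hone];
  lat_cocompact : exists2 K : set (H21 R), compact K &
    forall x, exists2 g, lat g & exists2 k, K k & x = hmul g k }.

Section Quotients.
Variable Gam : lattice.

Definition lat_rel : rel (H21 R) :=
  fun x y => `[< exists2 g, lat Gam g & y = hmul g x >].

Lemma lat_rel_refl : reflexive lat_rel.
Proof.
by move=> x; apply/asboolP; exists hone; [exact: lat_one|rewrite hmul1x].
Qed.

Lemma lat_rel_sym : symmetric lat_rel.
Proof.
suff h x y : lat_rel x y -> lat_rel y x by move=> x y; apply/idP/idP; exact: h.
move=> /asboolP[g Gg ->]; apply/asboolP; exists (hinv g); first exact: lat_inv.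
by rewrite hmulA hmulVx hmul1x.
Qed.

Lemma lat_rel_trans : transitive lat_rel.
Proof.
move=> y x z /asboolP[g Gg ->] /asboolP[h Gh ->]; apply/asboolP.
by exists (hmul h g); [exact: lat_mul|rewrite hmulA].
Qed.

Canonical lat_equiv := EquivRel lat_rel lat_rel_refl lat_rel_sym lat_rel_trans.

Definition nil5 := {eq_quot lat_equiv}.

End Quotients.

Definition circ_rel : rel R := fun s r => (r - s) \is a Num.int.

Lemma circ_rel_refl : reflexive circ_rel.
Proof. by move=> s; rewrite /circ_rel subrr rpred0. Qed.

Lemma circ_rel_sym : symmetric circ_rel.
Proof. by move=> s r; rewrite /circ_rel -rpredN opprB. Qed.

Lemma circ_rel_trans : transitive circ_rel.
Proof.
move=> r s q sr rq; rewrite /circ_rel.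
by rewrite -(subrK r q) -addrA; apply: rpredD.
Qed.

Canonical circ_equiv :=
  EquivRel circ_rel circ_rel_refl circ_rel_sym circ_rel_trans.

(* S^1 = R/Z *)
Definition circle := {eq_quot circ_equiv}.

Definition M3 (Gam : lattice) := (nil5 Gam * circle)%type.

End Heisenberg.

(* H(2,1) x R; the same vector space is used for its Lie algebra, i.e. the
   tangent space at the identity in the coordinates ((a, b, c), s). *)
Notation h3 R := (H21 R * R)%type.

Section Calculus.
Variables (R : realType) (Gam : lattice R).
Notation M := (M3 Gam).
Notation h := (h3 R).

(* commutator of the corresponding matrices *)
Definition lieh (v w : h) : h :=
  ((0, 0, (v.1.1.1 *m w.1.1.2) 0 0 - (w.1.1.1 *m v.1.1.2) 0 0), 0).

Definition cover_map (x : h) : M := (\pi_(nil5 Gam) x.1, \pi_(circle R) x.2).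
Definition lift_pt (p : M) : h := (repr p.1, repr p.2).

(* differential at the identity of the left translation by x *)
Definition dL (x v : h) : h :=
  ((v.1.1.1, v.1.1.2, v.1.2 + (x.1.1.1 *m v.1.1.2) 0 0), v.2).

Lemma derive_dL (x v w : h) : 'D_v (dL^~ w) x =
  ((0, 0, (v.1.1.1 *m w.1.1.2) 0 0), 0).
Proof.
rewrite /derive; apply: cvg_lim => //; apply: cvg_near_cst.
near=> k.
have k0 : k != 0 by near: k; exact: nbhs_dnbhs_neq.
have -> : (dL^~ w \o shift x) (k *: v) - dL x w =
    k *: (((0, 0, (v.1.1.1 *m w.1.1.2) 0 0), 0) : h).
  case: x v w => [[[a b] c] s] [[[a' b'] c'] s'] [[[p q] r] s''].
  transitivity ((p - p, q - q, r + ((k *: a' + a) *m q) 0 0 -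
    (r + (a *m q) 0 0), s'' - s'') : h) => //.
  transitivity ((k *: 0, k *: 0, k * (a' *m q) 0 0, k * 0) : h) => //.
  rewrite !subrr !scaler0 mulr0 mulmxDl -scalemxAl !mxE; congr (_, _, _, _).
  by ring.
by rewrite scalerA mulVf// scale1r.
Unshelve. all: by end_near. Qed.

(* lieh is the bracket of the left-invariant vector fields x |-> dL x v *)
Lemma lieh_dL (x v w : h) :
  'D_(dL x v) (dL^~ w) x - 'D_(dL x w) (dL^~ v) x = dL x (lieh v w).
Proof.
rewrite !derive_dL /dL /lieh /=; congr (_, _, _, _); rewrite ?subrr//.
by rewrite mulmx0 [X in _ = _ + X]mxE addr0.
Qed.

(* M is parallelized by the left-invariant vector fields: from here on the
   tangent space at each point of M is h, the vector v at p standing for the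
   value at p of the field on M induced by the left-invariant field x |-> dL x v.
   Thus a vector field is a map M -> h (a constant map if it is left invariant)
   and a covariant tensor field is a map M -> h -> .. -> h -> R.
   der v u is the derivative of u along the left-invariant field v. *)
Definition der (V : normedModType R) (v : h) (u : M -> V) (p : M) : V :=
  'D_(dL (lift_pt p) v) (u \o cover_map) (lift_pt p).

Lemma cover_mapK p : cover_map (lift_pt p) = p.
Proof. by case: p => p1 p2; rewrite /cover_map /lift_pt /= !reprK. Qed.

Lemma pi_nil5P (x y : H21 R) :
  \pi_(nil5 Gam) x = \pi y <-> exists2 g, lat Gam g & y = hmul g x.
Proof.
by split=> [/eqmodP/asboolP//|xy]; apply/eqmodP/asboolP.
Qed.

Lemma pi_circleP (s r : R) : \pi_(circle R) s = \pi r <-> (r - s) \is a Num.int.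
Proof. by split=> [/eqmodP//|sr]; apply/eqmodP. Qed.

Lemma dL_hmul (g : H21 R) (k : R) (x y v : h) : y.1 = hmul g x.1 ->
  (k *: dL y v + y).1 = hmul g (k *: dL x v + x).1.
Proof.
case: x v y g => [[[a b] c] s] [[[a' b'] c'] s'] [y s''] [[p q] r] ey.
rewrite -[y]/(y, s'').1 ey {ey}.
transitivity ((k *: a' + (p + a), k *: b' + (q + b),
  k * (c' + ((p + a) *m b') 0 0) + (r + c + (p *m b) 0 0)) : H21 R) => //.
transitivity ((p + (k *: a' + a), q + (k *: b' + b),
  r + (k * (c' + (a *m b') 0 0) + c) + (p *m (k *: b' + b)) 0 0) : H21 R) => //.
rewrite [p + (_ + _)]addrCA [q + (_ + _)]addrCA; congr (_, _, _).
rewrite mulmxDr mulmxDl -scalemxAr !mxE.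
by ring.
Qed.

(* der does not depend on the representatives chosen by lift_pt *)
Lemma der_cover (V : normedModType R) v (u : M -> V) x :
  der v u (cover_map x) = 'D_(dL x v) (u \o cover_map) x.
Proof.
have /pi_nil5P[g Gg eg] :
    \pi_(nil5 Gam) x.1 = \pi_(nil5 Gam) (lift_pt (cover_map x)).1.
  by rewrite reprK.
have /pi_circleP cn :
    \pi_(circle R) x.2 = \pi_(circle R) (lift_pt (cover_map x)).2.
  by rewrite reprK.
rewrite /der; move: (lift_pt (cover_map x)) eg cn => y eg cn.
have key (k : R) : cover_map (k *: dL y v + y) = cover_map (k *: dL x v + x).
  apply: esym; rewrite /cover_map; congr (_, _).
    by apply/pi_nil5P; exists g => //; exact: dL_hmul.
  apply/pi_circleP; rewrite -[X in X - _]/(k * v.2 + y.2).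
  by rewrite -[X in _ - X]/(k * v.2 + x.2) opprD addrACA subrr add0r.
have key0 : cover_map y = cover_map x by have := key 0; rewrite !scale0r !add0r.
rewrite /derive; apply: (congr1 (fun F : R -> V => lim (F @ 0^'))).
apply/funext => k.
by rewrite /= key key0.
Qed.

End Calculus.

Section Tensors.
Variables (R : realType) (Gam : lattice R).
Notation M := (M3 Gam).
Notation h := (h3 R).

(* Differential forms are evaluated with the determinant convention
   (a /\ b)(v, w) = a v * b w - a w * b v. *)

Definition wedge11 (a b : h -> R) (v w : h) : R := a v * b w - a w * b v.

Definition wedge22 (a b : h -> h -> R) (v0 v1 v2 v3 : h) : R :=
  a v0 v1 * b v2 v3 - a v0 v2 * b v1 v3 + a v0 v3 * b v1 v2
  + a v1 v2 * b v0 v3 - a v1 v3 * b v0 v2 + a v2 v3 * b v0 v1.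

(* Exterior derivative of forms of degree 1, 2, 3, by the invariant formula on
   left-invariant fields. *)

Definition ext1 (a : M -> h -> R) (p : M) (v0 v1 : h) : R :=
  der v0 (fun q => a q v1) p - der v1 (fun q => a q v0) p - a p (lieh v0 v1).

Definition ext2 (a : M -> h -> h -> R) (p : M) (v0 v1 v2 : h) : R :=
  der v0 (fun q => a q v1 v2) p - der v1 (fun q => a q v0 v2) p
  + der v2 (fun q => a q v0 v1) p
  - a p (lieh v0 v1) v2 + a p (lieh v0 v2) v1 - a p (lieh v1 v2) v0.

Definition ext3 (a : M -> h -> h -> h -> R) (p : M) (v0 v1 v2 v3 : h) : R :=
  der v0 (fun q => a q v1 v2 v3) p - der v1 (fun q => a q v0 v2 v3) p
  + der v2 (fun q => a q v0 v1 v3) p - der v3 (fun q => a q v0 v1 v2) p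
  - a p (lieh v0 v1) v2 v3 + a p (lieh v0 v2) v1 v3 - a p (lieh v0 v3) v1 v2
  - a p (lieh v1 v2) v0 v3 + a p (lieh v1 v3) v0 v2 - a p (lieh v2 v3) v0 v1.

Definition vbracket (X Y : M -> h) (p : M) : h :=
  der (X p) Y p - der (Y p) X p + lieh (X p) (Y p).

(* A connection on TM is given by the covariant derivatives A p v w, at p, of
   the left-invariant fields w in the directions v. *)
Definition conn := M -> h -> h -> h.

Definition nabla (A : conn) (v : h) (Y : M -> h) (p : M) : h :=
  der v Y p + A p v (Y p).

Definition curv (A : conn) (p : M) (v w z : h) : h :=
  nabla A v (nabla A w (cst z)) p - nabla A w (nabla A v (cst z)) p
  - nabla A (lieh v w) (cst z) p.

Definition nabla2 (A : conn) (F : M -> h -> h -> R) (p : M) (v w z : h) : R :=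
  der v (fun q => F q w z) p - F p (A p v w) z - F p w (A p v z).

Definition nabla3 (A : conn) (H : M -> h -> h -> h -> R) (p : M)
    (v w z y : h) : R :=
  der v (fun q => H q w z y) p
  - H p (A p v w) z y - H p w (A p v z) y - H p w z (A p v y).

(* covariant derivative of the curvature of A, with A acting on the
   endomorphism part and P on the two form arguments *)
Definition nabla_curv (P A : conn) (p : M) (v w z s : h) : h :=
  nabla A v (fun q => curv A q w z s) p - curv A p w z (A p v s)
  - curv A p (P p v w) z s - curv A p w (P p v z) s.

(* frm is an orthonormal frame, in which the traces below are computed *)
Record hstruct := HStruct {
  met : M -> h -> h -> R;
  cpl : M -> h -> h;
  frm : 'I_6 -> M -> h }.

Section Structure.
Variable S : hstruct.
Notation g := (met S).
Notation J := (cpl S).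
Notation E := (frm S).

Definition riemannian : Prop :=
  [/\ forall p w, scalar (fun v => g p v w),
      forall p v w, g p v w = g p w v &
      forall p v, v != 0 -> 0 < g p v v].

Definition orthonormal_frame : Prop :=
  (forall p i j, g p (E i p) (E j p) = (i == j)%:R) /\
  (forall p v, v = \sum_k g p v (E k p) *: E k p).

Definition nijenhuis (p : M) (v w : h) : h :=
  vbracket (J^~ v) (J^~ w) p - J p (vbracket (J^~ v) (cst w) p)
  - J p (vbracket (cst v) (J^~ w) p) - vbracket (cst v) (cst w) p.

Definition complex_structure : Prop :=
  [/\ forall p, linear (J p), forall p v, J p (J p v) = - v &
      forall p v w, nijenhuis p v w = 0].

Definition hermitian_structure : Prop :=
  [/\ riemannian, orthonormal_frame, complex_structure &
      forall p v w, g p (J p v) (J p w) = g p v w].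

Definition kform (p : M) (v w : h) : R := g p v (J p w).

Definition torsion (p : M) (v w z : h) : R :=
  - ext2 kform p (J p v) (J p w) (J p z).

(* 2 g(nabla_v w, z) for the Levi-Civita connection (Koszul formula) *)
Definition koszul (p : M) (v w z : h) : R :=
  der v (fun q => g q w z) p + der w (fun q => g q v z) p
  - der z (fun q => g q v w) p
  + g p (lieh v w) z - g p (lieh v z) w - g p (lieh w z) v.

Definition levi_civita : conn := fun p v w =>
  \sum_k (2^-1 * koszul p v w (E k p)) *: E k p.

Definition bismut : conn := fun p v w =>
  levi_civita p v w + \sum_k (2^-1 * torsion p v w (E k p)) *: E k p.

Definition codiff2 (F : M -> h -> h -> R) (p : M) (v : h) : R :=
  - \sum_k nabla2 levi_civita F p (E k p) (E k p) v.

Definition lee (p : M) (v : h) : R := codiff2 kform p (J p v).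

Definition balanced : Prop := forall p v, lee p v = 0.

(* g(R(v, w) E_a, E_b) *)
Definition curvm (A : conn) (p : M) (a b : 'I_6) (v w : h) : R :=
  g p (curv A p v w (E a p)) (E b p).

Definition ricci (p : M) (v w : h) : R :=
  \sum_k g p (curv levi_civita p (E k p) v w) (E k p).

Definition pont1 (A : conn) (p : M) (v0 v1 v2 v3 : h) : R :=
  (8 * pi ^+ 2)^-1 * \sum_(i < 6) \sum_(j < 6 | (i < j)%N)
    wedge22 (curvm A p j i) (curvm A p j i) v0 v1 v2 v3.

Definition trRR (A : conn) (p : M) (v0 v1 v2 v3 : h) : R :=
  \sum_(a < 6) \sum_(b < 6)
    wedge22 (curvm A p a b) (curvm A p a b) v0 v1 v2 v3.

Definition instanton (A : conn) : Prop :=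
  (forall p v w z, curv A p (J p v) (J p w) z = curv A p v w z) /\
  (forall p z, \sum_k curv A p (E k p) (J p (E k p)) z = 0).

(* Hol(nabla^+) in su(3), expressed by the vanishing of the Ricci form of
   nabla^+ (nabla^+ preserves g and J) *)
Definition hol_plus_su3 : Prop := forall p v w,
  \sum_i g p (curv bismut p v w (J p (E i p))) (E i p) = 0.

Definition susy (A : conn) : Prop :=
  [/\ hermitian_structure, hol_plus_su3, balanced & instanton A].

End Structure.

(* In the next two definitions A is a connection on TM with bundle metric and
   orthonormal frame those of SA, and Rc is the connection on (TM, met S) whose
   curvature is R. *)

Definition bianchi (S SA : hstruct) (A Rc : conn) (alpha : R) : Prop :=
  forall p v0 v1 v2 v3, ext3 (torsion S) p v0 v1 v2 v3 =
    alpha / 4 * (trRR S Rc p v0 v1 v2 v3 - trRR SA A p v0 v1 v2 v3).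

Definition eom (S SA : hstruct) (A Rc : conn) (alpha : R) : Prop :=
  let E := frm S in let H := torsion S in
  [/\ forall p i j,
        ricci S p (E i p) (E j p)
        - 4^-1 * (\sum_m \sum_n
            H p (E i p) (E m p) (E n p) * H p (E j p) (E m p) (E n p))
        - alpha / 4 *
          ((\sum_m \sum_a \sum_b
              curvm SA A p a b (E i p) (E m p) *
              curvm SA A p a b (E j p) (E m p))
           - \sum_m \sum_a \sum_b
              curvm S Rc p a b (E i p) (E m p) *
              curvm S Rc p a b (E j p) (E m p)) = 0,
      forall p j k,
        \sum_i nabla3 (levi_civita S) H p (E i p) (E i p) (E j p) (E k p) = 0 &
      forall p j s,
        \sum_i nabla_curv (bismut S) A p (E i p) (E i p) (E j p) s = 0].

(* f^1, .., f^6 are f (ix 1), .., f (ix 6) *)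
Definition ix (k : nat) : 'I_6 := inord k.-1.

Definition dual_frame (f : 'I_6 -> {scalar h}) (B : 'I_6 -> h) : Prop :=
  (forall i j, f i (B j) = (i == j)%:R) /\ (forall v, v = \sum_i f i v *: B i).

Definition structure_eqs (f : 'I_6 -> {scalar h}) : Prop :=
  (forall i : 'I_6, (i < 5)%N -> forall p v w, ext1 (fun=> f i) p v w = 0) /\
  (forall p v w, ext1 (fun=> f (ix 6)) p v w =
     - 2 * wedge11 (f (ix 1)) (f (ix 2)) v w
     + 2 * wedge11 (f (ix 3)) (f (ix 4)) v w).

Definition coframe_t (f : 'I_6 -> {scalar h}) (t : R) (i : 'I_6) (v : h) : R :=
  if i == ix 6 then t * f i v else f i v.

Definition frame_t (B : 'I_6 -> h) (t : R) (i : 'I_6) : h :=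
  if i == ix 6 then t^-1 *: B i else B i.

Definition hstruct_t (f : 'I_6 -> {scalar h}) (B : 'I_6 -> h) (t : R) : hstruct :=
  let e k := coframe_t f t (ix k) in let E k := frame_t B t (ix k) in
  {| met := fun _ v w => \sum_i coframe_t f t i v * coframe_t f t i w;
     cpl := fun _ v => e 2 v *: E 1 - e 1 v *: E 2 + e 4 v *: E 3 - e 3 v *: E 4
                     + e 6 v *: E 5 - e 5 v *: E 6;
     frm := fun i _ => frame_t B t i |}.

End Tensors.

(* Main.v *)
Require Import Defs.
From mathcomp Require Import all_boot all_order all_algebra.
From mathcomp Require Import ring lra.
From mathcomp Require Import all_classical all_reals all_analysis.

Import Order.TTheory GRing.Theory Num.Theory.
Import numFieldNormedType.Exports.

Local Open Scope ring_scope.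

(** The frame only sees one two-form: with sigma = f^12 - f^34 the bracket is
    [v, w] = 2 sigma(v, w) B_6, and rot, the skew endomorphism of <B_1..B_4>
    dual to sigma, commutes with the complex structure and has no trace against
    it. As the metric and complex structure are left invariant, every operator
    in the statement reduces to algebra in the Lie algebra, and solving
    Koszul's formula gives

      nabla^g_v w = sigma(v, w) B_6 - t^2 f^6(w) rot v - t^2 f^6(v) rot w,
      T = - 2 t^2 f^6 /\ sigma,        dT = 4 t^2 sigma /\ sigma,
      nabla^+_v w = - 2 t^2 f^6(v) rot w.

    So nabla^+ takes values in the line spanned by rot: its connection form is
    abelian, and its curvature is just R^+(v, w) = 4 t^2 sigma(v, w) rot
    (curv_bismut). Both factors are independent of t up to the scalar, which is
    the heart of the matter: sigma is of type (1,1) and primitive for every J_t,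
    hence nabla^+_t' is an instanton for every t (instanton_bismut), and rot is
    traceless against J, hence Hol(nabla^+) is in su(3).

    All the four-forms involved are multiples of sigma /\ sigma. The bundle
    metric g_t' sees rot as an isometry of <B_1..B_4>, so
    p_1(nabla^+_t) = (4 t^4 / pi^2) sigma /\ sigma (pont1_bismut). For the
    Levi-Civita connection most curvature entries are decomposable two-forms,
    whose squares vanish; only the (1,2) and (3,4) entries survive and give
    p_1(nabla^g_t) = (3 t^4 / 2 pi^2) sigma /\ sigma (pont1_levi_civita).
    Comparison with dT gives (a) and (b), and, since Tr(R /\ R) = 16 pi^2 p_1,
    also the two values of alpha'.

    For the equations of motion, the Bianchi identity with R = R^+ forces
    t^2 = 4 alpha' (t^4 - t'^4) (bianchi_bismutP, by evaluating on B_1..B_4,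
    where sigma /\ sigma does not vanish). Writing h for the horizontal metric
    f^1 f^1 + .. + f^4 f^4, the Einstein equation reads
      (- 2 t^2 h + 4 t^4 f^6 f^6) - (2 t^2 h + 4 t^4 f^6 f^6)
        + 16 alpha' (t^4 - t'^4) h = 0,
    which is that same relation; the other two equations hold because the frame
    fields are autoparallel and sigma is coclosed and horizontal. *)

(** * Sums over six indices *)

Lemma ixK k : (k.-1 < 6)%N -> ix k = k.-1 :> nat.
Proof. exact: inordK. Qed.

Lemma ord6_ind (P : 'I_6 -> Prop) :
  P (ix 1) -> P (ix 2) -> P (ix 3) -> P (ix 4) -> P (ix 5) -> P (ix 6) ->
  forall i, P i.
Proof.
move=> P1 P2 P3 P4 P5 P6 [i ltI]; do 6?[case: i ltI => [|i] ltI //].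
- by rewrite (_ : Ordinal ltI = ix 1)//; apply/val_inj; rewrite /= ixK.
- by rewrite (_ : Ordinal ltI = ix 2)//; apply/val_inj; rewrite /= ixK.
- by rewrite (_ : Ordinal ltI = ix 3)//; apply/val_inj; rewrite /= ixK.
- by rewrite (_ : Ordinal ltI = ix 4)//; apply/val_inj; rewrite /= ixK.
- by rewrite (_ : Ordinal ltI = ix 5)//; apply/val_inj; rewrite /= ixK.
- by rewrite (_ : Ordinal ltI = ix 6)//; apply/val_inj; rewrite /= ixK.
Qed.

Lemma sum6 (V : nmodType) (F : 'I_6 -> V) :
  \sum_i F i = F (ix 1) + F (ix 2) + F (ix 3) + F (ix 4) + F (ix 5) + F (ix 6).
Proof.
rewrite !big_ord_recr big_ord0 /= add0r.
do ![congr (_ + _)]; congr (F _); apply/val_inj; by rewrite /= ixK.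
Qed.

Lemma sum_pairs (V : nmodType) (F : 'I_6 -> 'I_6 -> V) :
  \sum_(i < 6) \sum_(j < 6 | (i < j)%N) F i j =
  F (ix 1) (ix 2) + F (ix 1) (ix 3) + F (ix 1) (ix 4) + F (ix 1) (ix 5)
  + F (ix 1) (ix 6)
  + (F (ix 2) (ix 3) + F (ix 2) (ix 4) + F (ix 2) (ix 5) + F (ix 2) (ix 6))
  + (F (ix 3) (ix 4) + F (ix 3) (ix 5) + F (ix 3) (ix 6))
  + (F (ix 4) (ix 5) + F (ix 4) (ix 6)) + F (ix 5) (ix 6).
Proof.
under eq_bigr do rewrite big_mkcond sum6 !ixK//.
by rewrite sum6 /= !ixK//= !(add0r, addr0).
Qed.

(** Relates traces over all matrix index pairs to the sum over i < j in p_1; the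
    terms will be squares of entries of skew matrices. *)
Lemma sum_sym (V : nmodType) n (F : 'I_n -> 'I_n -> V) :
  (forall i, F i i = 0) -> (forall i j, F i j = F j i) ->
  \sum_i \sum_j F i j = (\sum_(i < n) \sum_(j < n | (i < j)%N) F i j) *+ 2.
Proof.
move=> F0 Fsym; rewrite mulr2n.
transitivity (\sum_(i < n) (\sum_(j < n | (i < j)%N) F i j +
                            \sum_(j < n | (j < i)%N) F i j)).
  apply: eq_bigr => i _; rewrite (bigID (fun j : 'I_n => (i < j)%N)) /=.
  congr (_ + _); rewrite (bigD1 i) ?ltnn//= F0 add0r; apply: eq_bigl => j.
  by rewrite -leqNgt ltn_neqAle andbC.
rewrite big_split /=; congr (_ + _); rewrite (exchange_big_dep predT)//=.
by apply: eq_bigr => j _; apply: eq_bigr => i _; rewrite Fsym.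
Qed.

(** * Left-invariant tensors *)

Section Invariant.
Set Implicit Arguments.
Unset Strict Implicit.
Context {R : realType} {Gam : lattice R}.
Notation h := (h3 R).
Implicit Types (p : M3 Gam) (v w z : h).

Lemma der_cst (V : normedModType R) (c : V) v p : der v (fun=> c) p = 0.
Proof. exact: derive_cst. Qed.

Lemma ext2_inv (a : h -> h -> R) p v0 v1 v2 :
  ext2 (fun=> a) p v0 v1 v2 =
  - a (lieh v0 v1) v2 + a (lieh v0 v2) v1 - a (lieh v1 v2) v0.
Proof. by rewrite /ext2 !der_cst !subrr !add0r. Qed.

Lemma ext3_inv (a : h -> h -> h -> R) p v0 v1 v2 v3 :
  ext3 (fun=> a) p v0 v1 v2 v3 =
  - a (lieh v0 v1) v2 v3 + a (lieh v0 v2) v1 v3 - a (lieh v0 v3) v1 v2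
  - a (lieh v1 v2) v0 v3 + a (lieh v1 v3) v0 v2 - a (lieh v2 v3) v0 v1.
Proof. by rewrite /ext3 !der_cst !(subrr, add0r). Qed.

Lemma nabla_inv (a : h -> h -> h) v w p :
  nabla (fun=> a) v (fun _ : M3 Gam => w) p = a v w.
Proof. by rewrite /nabla der_cst add0r. Qed.

Lemma vbracket_inv v w p :
  vbracket (fun _ : M3 Gam => v) (fun=> w) p = lieh v w.
Proof. by rewrite /vbracket !der_cst subr0 add0r. Qed.

Lemma curv_inv (a : h -> h -> h) p v w z :
  curv (fun _ : M3 Gam => a) p v w z =
  a v (a w z) - a w (a v z) - a (lieh v w) z.
Proof.
rewrite /curv.
have E u y : nabla (fun=> a) u (cst y) = (fun _ : M3 Gam => a u y).
  by apply/funext => q; exact: nabla_inv.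
by rewrite !E.
Qed.
End Invariant.

(** * Algebra of the structures on the Lie algebra *)

(* V is any module with a basis B and its dual basis f: the group enters only
   through the bracket brk, and an abstract V keeps sums and multiples of
   vectors folded. *)
Section Model.
Set Implicit Arguments.
Unset Strict Implicit.
Variables (R : realType) (V : lmodType R).
Variables (f : 'I_6 -> {scalar V}) (B : 'I_6 -> V).
Hypothesis fB : forall i j, f i (B j) = (i == j)%:R.
Hypothesis fBE : forall v, v = \sum_i f i v *: B i.
Local Notation x k v := (f (ix k) v).
Local Notation b k := (B (ix k)).
Implicit Types (t : R) (u v w z : V).

Lemma coB k l : (k.-1 < 6)%N -> (l.-1 < 6)%N -> x k (b l) = (k.-1 == l.-1)%:R.
Proof. by move=> k6 l6; rewrite fB -val_eqE /= !ixK. Qed.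

(** Vectors are compared through their coordinates throughout, so that each
    tensor identity becomes six polynomial identities. *)
Lemma coordP v w : (forall k, f k v = f k w) -> v = w.
Proof.
move=> E; rewrite [v]fBE [w]fBE.
by apply: eq_bigr => k _; rewrite E.
Qed.

Lemma fD k v w : f k (v + w) = f k v + f k w. Proof. exact: linearD. Qed.
Lemma fN k v : f k (- v) = - f k v. Proof. exact: linearN. Qed.
Lemma fZ k a v : f k (a *: v) = a * f k v. Proof. exact: linearZ. Qed.

(** The two-form f^12 - f^34, of which df^6 is - 2 times; anti-self-dual on the
    horizontal space <B_1..B_4>. *)
Definition sigma v w : R := x 1 v * x 2 w - x 1 w * x 2 v
  - (x 3 v * x 4 w - x 3 w * x 4 v).

(** The endomorphism with h(rot v, w) = sigma(v, w), h the horizontal metric. *)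
Definition rot v : V :=
  x 1 v *: b 2 - x 2 v *: b 1 - x 3 v *: b 4 + x 4 v *: b 3.

Definition brk v w : V := (2 * sigma v w) *: b 6.

Definition hdot v w : R :=
  x 1 v * x 1 w + x 2 v * x 2 w + x 3 v * x 3 w + x 4 v * x 4 w.

Definition hproj v : V :=
  x 1 v *: b 1 + x 2 v *: b 2 + x 3 v *: b 3 + x 4 v *: b 4.

Definition met_t t v w : R :=
  hdot v w + x 5 v * x 5 w + t ^+ 2 * (x 6 v * x 6 w).

Definition cpl_t t v : V := x 2 v *: b 1 - x 1 v *: b 2 + x 4 v *: b 3
   - x 3 v *: b 4 + (t * x 6 v) *: b 5 - (t^-1 * x 5 v) *: b 6.

Definition kform_t t v w : R := x 1 v * x 2 w - x 1 w * x 2 v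
  + (x 3 v * x 4 w - x 3 w * x 4 v) + t * (x 5 v * x 6 w - x 5 w * x 6 v).

Definition tor_t t v w z : R :=
  - (2 * t ^+ 2) * (x 6 v * sigma w z - x 6 w * sigma v z + x 6 z * sigma v w).

(** The solution of Koszul's formula for the metric met_t; see met_t_lc. *)
Definition lc_t t v w : V :=
  sigma v w *: b 6 - (t ^+ 2 * x 6 w) *: rot v - (t ^+ 2 * x 6 v) *: rot w.

(** The Bismut connection: only the fibre direction B_6 rotates anything, and it
    always rotates by the same rot, so its values all commute. *)
Definition bis_t t v w : V := (- (2 * t ^+ 2 * x 6 v)) *: rot w.

(** The curvature of lc_t, from O'Neill's terms for the fibration with totally
    geodesic fibres along B_6. *)
Definition lcR_t t v w z : V := t ^+ 2 *:
  ((x 6 v * hdot w z - x 6 w * hdot v z) *: b 6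
   - sigma w z *: rot v + sigma v z *: rot w
   - (t ^+ 2 * x 6 z) *: (x 6 v *: hproj w - x 6 w *: hproj v)
   + (2 * sigma v w) *: rot z).

Lemma rotE v : ((x 1 (rot v) = - x 2 v) * (x 2 (rot v) = x 1 v)
  * (x 3 (rot v) = x 4 v) * (x 4 (rot v) = - x 3 v)
  * (x 5 (rot v) = 0) * (x 6 (rot v) = 0))%type.
Proof. by rewrite /rot !(fD, fN, fZ) !coB //=; do !split; ring. Qed.

Lemma hprojE v : ((x 1 (hproj v) = x 1 v) * (x 2 (hproj v) = x 2 v)
  * (x 3 (hproj v) = x 3 v) * (x 4 (hproj v) = x 4 v)
  * (x 5 (hproj v) = 0) * (x 6 (hproj v) = 0))%type.
Proof. by rewrite /hproj !(fD, fN, fZ) !coB //=; do !split; ring. Qed.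

Lemma cpl_tE t v : ((x 1 (cpl_t t v) = x 2 v) * (x 2 (cpl_t t v) = - x 1 v)
  * (x 3 (cpl_t t v) = x 4 v) * (x 4 (cpl_t t v) = - x 3 v)
  * (x 5 (cpl_t t v) = (t * x 6 v)%R)
  * (x 6 (cpl_t t v) = (- (t^-1 * x 5 v))%R))%type.
Proof. by rewrite /cpl_t !(fD, fN, fZ) !coB //=; do !split; ring. Qed.

Lemma lc_tE t v w :
  ((x 1 (lc_t t v w) = (t ^+ 2 * (x 6 w * x 2 v + x 6 v * x 2 w))%R)
  * (x 2 (lc_t t v w) = (- t ^+ 2 * (x 6 w * x 1 v + x 6 v * x 1 w))%R)
  * (x 3 (lc_t t v w) = (- t ^+ 2 * (x 6 w * x 4 v + x 6 v * x 4 w))%R)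
  * (x 4 (lc_t t v w) = (t ^+ 2 * (x 6 w * x 3 v + x 6 v * x 3 w))%R)
  * (x 5 (lc_t t v w) = 0) * (x 6 (lc_t t v w) = sigma v w))%type.
Proof. by rewrite /lc_t !(rotE, fD, fN, fZ) ?coB //=; do !split; ring. Qed.

Lemma bis_tE t v w : ((x 1 (bis_t t v w) = (2 * t ^+ 2 * x 6 v * x 2 w)%R)
  * (x 2 (bis_t t v w) = (- (2 * t ^+ 2 * x 6 v * x 1 w))%R)
  * (x 3 (bis_t t v w) = (- (2 * t ^+ 2 * x 6 v * x 4 w))%R)
  * (x 4 (bis_t t v w) = (2 * t ^+ 2 * x 6 v * x 3 w)%R)
  * (x 5 (bis_t t v w) = 0) * (x 6 (bis_t t v w) = 0))%type.
Proof. by rewrite /bis_t !(rotE, fD, fN, fZ) ?coB //=; do !split; ring. Qed.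

Lemma brkE v w :
  ((x 1 (brk v w) = 0) * (x 2 (brk v w) = 0) * (x 3 (brk v w) = 0)
  * (x 4 (brk v w) = 0) * (x 5 (brk v w) = 0)
  * (x 6 (brk v w) = (2 * sigma v w)%R))%type.
Proof. by rewrite /brk !(fD, fN, fZ) !coB //=; do !split; ring. Qed.

Lemma lcR_tE t v w z :
  ((x 1 (lcR_t t v w z) =
    (t ^+ 2 * (sigma w z * x 2 v - sigma v z * x 2 w
      - t ^+ 2 * x 6 z * (x 6 v * x 1 w - x 6 w * x 1 v)
      - 2 * sigma v w * x 2 z))%R)
  * (x 2 (lcR_t t v w z) =
    (t ^+ 2 * (sigma v z * x 1 w - sigma w z * x 1 v
      - t ^+ 2 * x 6 z * (x 6 v * x 2 w - x 6 w * x 2 v)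
      + 2 * sigma v w * x 1 z))%R)
  * (x 3 (lcR_t t v w z) =
    (t ^+ 2 * (sigma v z * x 4 w - sigma w z * x 4 v
      - t ^+ 2 * x 6 z * (x 6 v * x 3 w - x 6 w * x 3 v)
      + 2 * sigma v w * x 4 z))%R)
  * (x 4 (lcR_t t v w z) =
    (t ^+ 2 * (sigma w z * x 3 v - sigma v z * x 3 w
      - t ^+ 2 * x 6 z * (x 6 v * x 4 w - x 6 w * x 4 v)
      - 2 * sigma v w * x 3 z))%R)
  * (x 5 (lcR_t t v w z) = 0)
  * (x 6 (lcR_t t v w z) =
    (t ^+ 2 * (x 6 v * hdot w z - x 6 w * hdot v z))%R))%type.
Proof.
by rewrite /lcR_t !(rotE, hprojE, fD, fN, fZ) ?coB //=; do !split; ring.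
Qed.

Local Notation coE :=
  (lcR_tE, lc_tE, bis_tE, brkE, cpl_tE, rotE, hprojE) (only parsing).

(** The commutator of bis_t v and bis_t w vanishes, both being multiples of rot;
    what is left is - bis_t on the bracket 2 sigma(v, w) B_6. *)
Lemma bis_curv t v w z :
  bis_t t v (bis_t t w z) - bis_t t w (bis_t t v z) - bis_t t (brk v w) z =
  (4 * t ^+ 2 * sigma v w) *: rot z.
Proof.
by apply: coordP; apply: ord6_ind; rewrite ?(coE, fD, fN, fZ) /sigma; ring.
Qed.

Lemma lc_curv t v w z :
  lc_t t v (lc_t t w z) - lc_t t w (lc_t t v z) - lc_t t (brk v w) z =
  lcR_t t v w z.
Proof.
by apply: coordP; apply: ord6_ind;
  rewrite !(coE, fD, fN) /sigma /hdot ?coE; ring.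
Qed.

Lemma met_t_lc t v w z :
  2^-1 * (met_t t (brk v w) z - met_t t (brk v z) w - met_t t (brk w z) v)
  = met_t t (lc_t t v w) z.
Proof. by rewrite /met_t /hdot !coE /sigma; field. Qed.

Lemma bis_lc t v w z :
  2^-1 * tor_t t v w z = met_t t (bis_t t v w - lc_t t v w) z.
Proof. by rewrite /met_t /hdot !(coE, fD, fN) /tor_t /sigma; field. Qed.

Lemma met_tC t v w : met_t t v w = met_t t w v.
Proof. by rewrite /met_t /hdot; ring. Qed.

Lemma met_t_scalar t w : scalar (fun v => met_t t v w).
Proof. by move=> a u v; rewrite /met_t /hdot !(fD, fZ) /=; ring. Qed.

Lemma met_t_gt0 t v : t != 0 -> v != 0 -> 0 < met_t t v v.
Proof.
move=> t0; rewrite lt_def andbC => v0.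
have sq0 k : 0 <= x k v * x k v by rewrite -expr2 sqr_ge0.
have t6 : 0 <= t ^+ 2 * (x 6 v * x 6 v) by rewrite mulr_ge0 ?sqr_ge0.
have g0 : 0 <= met_t t v v by rewrite /met_t /hdot !addr_ge0.
rewrite g0 /=; apply: contra v0; rewrite /met_t /hdot !paddr_eq0 ?addr_ge0//.
rewrite !mulf_eq0 !orbb (negPf t0) /=.
move=> /andP[/andP[/andP[/andP[/andP[/eqP e1 /eqP e2] /eqP e3] /eqP e4]
  /eqP e5] /eqP e6].
by apply/eqP; apply: coordP; apply: ord6_ind; rewrite linear0.
Qed.

Lemma cpl_tK t v : t != 0 -> cpl_t t (cpl_t t v) = - v.
Proof.
by move=> t0; apply: coordP; apply: ord6_ind; rewrite !(coE, fN)//; field.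
Qed.

Lemma cpl_t_linear t : linear (cpl_t t).
Proof.
by move=> a u v; apply: coordP; apply: ord6_ind; rewrite !(coE, fD, fZ); ring.
Qed.

Lemma met_t_cpl t v w : t != 0 -> met_t t (cpl_t t v) (cpl_t t w) = met_t t v w.
Proof. by move=> t0; rewrite /met_t /hdot !coE; field. Qed.

Lemma kform_tE t v w : t != 0 -> met_t t v (cpl_t t w) = kform_t t v w.
Proof. by move=> t0; rewrite /met_t /hdot !coE /kform_t; field. Qed.

Lemma sigma_cpl t v w : sigma (cpl_t t v) (cpl_t t w) = sigma v w.
Proof. by rewrite /sigma !coE; ring. Qed.

(** The bracket is of type (1,1) because sigma is; this makes the complex
    structure abelian, hence integrable. *)
Lemma brk_cpl t v w : brk (cpl_t t v) (cpl_t t w) = brk v w.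
Proof. by rewrite /brk sigma_cpl. Qed.

Lemma brk_cplr t v w : brk v (cpl_t t w) = - brk (cpl_t t v) w.
Proof. by rewrite /brk -scaleNr; congr (_ *: _); rewrite /sigma !coE; ring. Qed.

Lemma cpl_tN t v : cpl_t t (- v) = - cpl_t t v.
Proof. by apply: coordP; apply: ord6_ind; rewrite !(coE, fN); ring. Qed.

Lemma kform_t_brk t u v w :
  kform_t t (brk u v) w = - (2 * t * sigma u v * x 5 w).
Proof. by rewrite /kform_t !brkE; ring. Qed.

Lemma tor_t_brk t u v w z :
  tor_t t (brk u v) w z = - (4 * t ^+ 2 * sigma u v * sigma w z).
Proof. by rewrite /tor_t /sigma !brkE /sigma; ring. Qed.

(** The endomorphism part of the curvature of any bis_t is parallel, both being
    multiples of rot. *)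
Lemma bis_rotZ t a v w :
  bis_t t v (a *: rot w) = a *: rot (bis_t t v w).
Proof. by apply: coordP; apply: ord6_ind; rewrite !(coE, fZ); ring. Qed.

Lemma met_t_rot t v w : met_t t (rot v) w = - met_t t v (rot w).
Proof. by rewrite /met_t /hdot !coE; ring. Qed.

Lemma met_t_lcR t v w z y :
  met_t t (lcR_t t v w z) y = - met_t t z (lcR_t t v w y).
Proof. by rewrite /met_t !coE /hdot !coE /sigma; ring. Qed.

(** * Contractions in the orthonormal frame *)

Section Frame.
Variable t : R.
Hypothesis t0 : t != 0.

Definition frm_t (i : 'I_6) : V := if i == ix 6 then t^-1 *: B i else B i.
Local Notation E k := (frm_t (ix k)).

Lemma frm_tE : ((E 1 = b 1) * (E 2 = b 2) * (E 3 = b 3) * (E 4 = b 4)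
  * (E 5 = b 5) * (E 6 = t^-1 *: b 6))%type.
Proof. by rewrite /frm_t -!val_eqE /= !ixK. Qed.

Lemma coE1 : ((x 1 (E 1) = 1) * (x 2 (E 1) = 0) * (x 3 (E 1) = 0)
  * (x 4 (E 1) = 0) * (x 5 (E 1) = 0) * (x 6 (E 1) = 0))%type.
Proof. by rewrite !frm_tE !coB. Qed.
Lemma coE2 : ((x 1 (E 2) = 0) * (x 2 (E 2) = 1) * (x 3 (E 2) = 0)
  * (x 4 (E 2) = 0) * (x 5 (E 2) = 0) * (x 6 (E 2) = 0))%type.
Proof. by rewrite !frm_tE !coB. Qed.
Lemma coE3 : ((x 1 (E 3) = 0) * (x 2 (E 3) = 0) * (x 3 (E 3) = 1)
  * (x 4 (E 3) = 0) * (x 5 (E 3) = 0) * (x 6 (E 3) = 0))%type.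
Proof. by rewrite !frm_tE !coB. Qed.
Lemma coE4 : ((x 1 (E 4) = 0) * (x 2 (E 4) = 0) * (x 3 (E 4) = 0)
  * (x 4 (E 4) = 1) * (x 5 (E 4) = 0) * (x 6 (E 4) = 0))%type.
Proof. by rewrite !frm_tE !coB. Qed.
Lemma coE5 : ((x 1 (E 5) = 0) * (x 2 (E 5) = 0) * (x 3 (E 5) = 0)
  * (x 4 (E 5) = 0) * (x 5 (E 5) = 1) * (x 6 (E 5) = 0))%type.
Proof. by rewrite !frm_tE !coB. Qed.
Lemma coE6 : ((x 1 (E 6) = 0) * (x 2 (E 6) = 0) * (x 3 (E 6) = 0)
  * (x 4 (E 6) = 0) * (x 5 (E 6) = 0) * (x 6 (E 6) = t^-1))%type.
Proof. by rewrite !frm_tE !fZ !coB //= !mulr0 mulr1. Qed.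
Local Notation coEE := (coE1, coE2, coE3, coE4, coE5, coE6) (only parsing).

Lemma met_t_frm v : ((met_t t v (E 1) = x 1 v) * (met_t t v (E 2) = x 2 v)
  * (met_t t v (E 3) = x 3 v) * (met_t t v (E 4) = x 4 v)
  * (met_t t v (E 5) = x 5 v) * (met_t t v (E 6) = (t * x 6 v)%R))%type.
Proof. by rewrite /met_t /hdot !coEE; do !split; field. Qed.

Lemma frm_t_orthonormal i j : met_t t (frm_t i) (frm_t j) = (i == j)%:R.
Proof.
by elim/ord6_ind: j; elim/ord6_ind: i;
  rewrite met_t_frm -val_eqE /= !ixK//= ?coEE ?divff ?mulr0.
Qed.

Lemma frm_t_expand v : v = \sum_k met_t t v (frm_t k) *: frm_t k.
Proof.
rewrite sum6 !met_t_frm !frm_tE scalerA mulrAC divff// mul1r [LHS]fBE.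
exact: sum6.
Qed.

(** Turns connections defined by their inner products with the frame into
    explicit vectors. *)
Lemma riesz v (phi : V -> R) : (forall z, phi z = met_t t v z) ->
   \sum_k phi (frm_t k) *: frm_t k = v.
Proof.
by move=> phiE; rewrite [RHS]frm_t_expand; apply: eq_bigr => k _; rewrite phiE.
Qed.

Lemma sigma_frm w : ((sigma (E 1) w = x 2 w) * (sigma (E 2) w = - x 1 w)
  * (sigma (E 3) w = - x 4 w) * (sigma (E 4) w = x 3 w)
  * (sigma (E 5) w = 0) * (sigma (E 6) w = 0))%type.
Proof. by rewrite /sigma !coEE; do !split; ring. Qed.

(** All entries but (2,1) and (4,3) are zero or decomposable two-forms. The
    coefficient - 3 is the sum of - 2, from the term 2 sigma(v, w) rot z, and of
    - 1, from the terms in rot v and rot w. *)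
Lemma lcR_frm v w :
  let r j i := met_t t (lcR_t t v w (E j)) (E i) in
  let W k l := x k v * x l w - x k w * x l v in
  ((r 2 1 = (- 3 * t ^+ 2 * W 1 2 + 2 * t ^+ 2 * W 3 4)%R)
  * (r 3 1 = (t ^+ 2 * W 2 4)%R) * (r 4 1 = (- t ^+ 2 * W 2 3)%R)
  * (r 3 2 = (- t ^+ 2 * W 1 4)%R) * (r 4 2 = (t ^+ 2 * W 1 3)%R)
  * (r 4 3 = (2 * t ^+ 2 * W 1 2 + - 3 * t ^+ 2 * W 3 4)%R)
  * (r 5 1 = 0) * (r 5 2 = 0) * (r 5 3 = 0) * (r 5 4 = 0)
  * (r 6 1 = (t ^+ 3 * W 1 6)%R) * (r 6 2 = (t ^+ 3 * W 2 6)%R)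
  * (r 6 3 = (t ^+ 3 * W 3 6)%R) * (r 6 4 = (t ^+ 3 * W 4 6)%R)
  * (r 6 5 = 0))%type.
Proof.
rewrite /= !met_t_frm !lcR_tE /sigma !coEE.
by do !split; field.
Qed.

Lemma ric_lc v w : \sum_k met_t t (lcR_t t (frm_t k) v w) (frm_t k) =
  - (2 * t ^+ 2) * hdot v w + 4 * t ^+ 4 * (x 6 v * x 6 w).
Proof. by rewrite sum6 !met_t_frm !coE /sigma /hdot !coEE; field. Qed.

Lemma sigma_sigma v w : \sum_m sigma v (frm_t m) * sigma w (frm_t m) = hdot v w.
Proof. by rewrite sum6 /sigma /hdot !coEE; ring. Qed.

Lemma tor_t_frm v w :
  ((tor_t t (E 1) v w = (2 * t ^+ 2 * (x 6 v * x 2 w - x 6 w * x 2 v))%R)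
  * (tor_t t (E 2) v w = (2 * t ^+ 2 * (x 6 w * x 1 v - x 6 v * x 1 w))%R)
  * (tor_t t (E 3) v w = (2 * t ^+ 2 * (x 6 w * x 4 v - x 6 v * x 4 w))%R)
  * (tor_t t (E 4) v w = (2 * t ^+ 2 * (x 6 v * x 3 w - x 6 w * x 3 v))%R)
  * (tor_t t (E 5) v w = 0)
  * (tor_t t (E 6) v w = (- (2 * t * sigma v w))%R))%type.
Proof. by rewrite /tor_t !(coEE, sigma_frm); do !split; field. Qed.

Lemma tor_t_cycle v w z : tor_t t v w z = tor_t t w z v.
Proof. by rewrite /tor_t /sigma; ring. Qed.

(** The contraction H_imn H_jmn, computed by moving the frame vectors to the
    front, where tor_t_frm lists the components. *)
Lemma tor_t_tor_t v w :
  \sum_m \sum_n tor_t t v (frm_t m) (frm_t n) * tor_t t w (frm_t m) (frm_t n) =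
  8 * t ^+ 2 * hdot v w + 16 * t ^+ 4 * (x 6 v * x 6 w).
Proof.
transitivity (\sum_m \sum_n
    tor_t t (frm_t m) (frm_t n) v * tor_t t (frm_t m) (frm_t n) w).
  apply: eq_bigr => m _; apply: eq_bigr => n _.
  by rewrite (tor_t_cycle v) (tor_t_cycle w).
rewrite sum6 !sum6 !tor_t_frm.
by rewrite !sigma_frm !coEE /hdot; field.
Qed.

(** rot is an isometry of the four-dimensional horizontal space. *)
Lemma rot_norm : \sum_a \sum_b
  met_t t (rot (frm_t a)) (frm_t b) * met_t t (rot (frm_t a)) (frm_t b) = 4.
Proof. by rewrite sum6 !sum6 !met_t_frm !coE !coEE; ring. Qed.

Lemma rot_norm_pairs : \sum_(i < 6) \sum_(j < 6 | (i < j)%N)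
  met_t t (rot (frm_t j)) (frm_t i) * met_t t (rot (frm_t j)) (frm_t i) = 2.
Proof. by rewrite sum_pairs !met_t_frm !coE !coEE; ring. Qed.

(** sigma is primitive: the contributions of the planes (1,2) and (3,4) cancel.
    This is the second instanton condition. *)
Lemma sigma_trace_cpl : \sum_k sigma (frm_t k) (cpl_t t (frm_t k)) = 0.
Proof. by rewrite sum6 /sigma !coE !coEE; ring. Qed.

(** rot lies in su(3), for the same cancellation reason; this gives the
    holonomy condition. *)
Lemma rot_trace_cpl : \sum_k met_t t (rot (cpl_t t (frm_t k))) (frm_t k) = 0.
Proof. by rewrite sum6 !met_t_frm !coE !coEE; ring. Qed.

(** The frame fields are geodesic, so no first-slot term survives in
    divergences. *)
Lemma lc_frm k : lc_t t (frm_t k) (frm_t k) = 0.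
Proof.
apply: coordP; elim/ord6_ind: k; apply: ord6_ind;
  rewrite ?coE ?coEE linear0 ?(mulr0, mul0r, addr0)//.
all: by rewrite /sigma !coEE; ring.
Qed.

Lemma bis_frm k : bis_t t (frm_t k) (frm_t k) = 0.
Proof.
by apply: coordP; elim/ord6_ind: k; apply: ord6_ind;
  rewrite ?coE ?coEE linear0 ?(mulr0, mul0r, oppr0).
Qed.

Lemma kform_t_coclosed u : \sum_k kform_t t (frm_t k) (lc_t t (frm_t k) u) = 0.
Proof. by rewrite sum6 /kform_t !(coE, coEE, sigma_frm); field. Qed.

Lemma tor_t_coclosed u v : \sum_k (tor_t t (frm_t k) (lc_t t (frm_t k) u) v
   + tor_t t (frm_t k) u (lc_t t (frm_t k) v)) = 0.
Proof.
rewrite sum6 !tor_t_frm /sigma !coE !(coEE, sigma_frm).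
by field.
Qed.

Lemma sigma_coclosed u : \sum_k sigma (frm_t k) (bis_t t (frm_t k) u) = 0.
Proof. by rewrite sum6 !sigma_frm !(coE, coEE); ring. Qed.

End Frame.

End Model.

(** * The Hermitian structures on the nilmanifold *)

Section Structures.
Set Implicit Arguments.
Unset Strict Implicit.
Variables (R : realType) (Gam : lattice R).
Notation h := (h3 R).
Variables (f : 'I_6 -> {scalar h}) (B : 'I_6 -> h).
Hypothesis hB : dual_frame f B.
Hypothesis hf : structure_eqs Gam f.
Let fB := hB.1.
Let fBE := hB.2.
Local Notation x k v := (f (ix k) v).
Local Notation b k := (B (ix k)).
Local Notation S t := (hstruct_t Gam f B t).
Implicit Types (v w z : h) (t : R) (p : M3 Gam).

(** Reads the bracket off the structure equations, by df(v, w) = - f([v, w]). *)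
Lemma lieE v w : lieh v w = brk f B v w.
Proof.
have p : M3 Gam := (\pi_(nil5 Gam) 0, \pi_(circle R) 0)%qT.
apply: (coordP fBE) => k; rewrite (fZ f); have [k5|] := boolP (k < 5)%N.
  have := hf.1 k k5 p v w; rewrite /ext1 !der_cst subrr sub0r => /eqP.
  rewrite oppr_eq0 => /eqP ->; rewrite fB -val_eqE /= ixK//.
  by rewrite ltn_eqF// mulr0.
rewrite -leqNgt => k5; have -> : k = ix 6.
  by apply/val_inj/eqP; rewrite /= ixK// eqn_leq k5 -ltnS ltn_ord.
have := hf.2 p v w; rewrite /ext1 !der_cst subrr sub0r => /(canRL opprK) ->.
by rewrite (coB fB) //= /sigma /wedge11; ring.
Qed.

Lemma coframeE t : (coframe_t f t (ix 1) = f (ix 1)) *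
  (coframe_t f t (ix 2) = f (ix 2)) * (coframe_t f t (ix 3) = f (ix 3)) *
  (coframe_t f t (ix 4) = f (ix 4)) * (coframe_t f t (ix 5) = f (ix 5)) *
  (coframe_t f t (ix 6) = fun v => t * x 6 v).
Proof. by rewrite /coframe_t -!val_eqE /= !ixK. Qed.

Lemma metE t : met (S t) = fun=> met_t f t.
Proof.
apply/funext => p; apply/funext => v; apply/funext => w.
by rewrite /= sum6 !coframeE /met_t /hdot; ring.
Qed.

Lemma frmE t i p : frm (S t) i p = frm_t B t i. Proof. by []. Qed.

Lemma cplE t : cpl (S t) = fun=> cpl_t f B t.
Proof.
apply/funext => p; apply/funext => v /=.
rewrite !coframeE -![frame_t B t _]/(frm_t B t _) !frm_tE scalerA /cpl_t.
by rewrite [_ * t^-1]mulrC.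
Qed.

Section OneParameter.
Variable t : R.
Hypothesis t0 : t != 0.

Lemma kformE : kform (S t) = fun=> kform_t f t.
Proof.
apply/funext => p; apply/funext => v; apply/funext => w.
by rewrite /kform metE cplE (kform_tE fB).
Qed.

(** As dF = 2 t f^5 /\ sigma and f^5 o J = t f^6, applying J to the three
    arguments turns f^5 into t f^6 and leaves sigma alone. *)
Lemma torsionE : torsion (S t) = fun=> tor_t f t.
Proof.
apply/funext => p; do 3![apply/funext => ?]; rewrite /torsion kformE.
rewrite ext2_inv !lieE !cplE !(brk_cpl fB) !(kform_t_brk fB).
by rewrite !(cpl_tE fB) /tor_t; ring.
Qed.

Lemma ext_torsion p v0 v1 v2 v3 : ext3 (torsion (S t)) p v0 v1 v2 v3 =
  4 * t ^+ 2 * wedge22 (sigma f) (sigma f) v0 v1 v2 v3.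
Proof.
by rewrite torsionE ext3_inv !lieE !(tor_t_brk fB) /wedge22; ring.
Qed.

(** The derivative terms of Koszul's formula vanish, and the bracket terms are
    those of met_t_lc. *)
Lemma levi_civitaE : levi_civita (S t) = fun=> lc_t f B t.
Proof.
apply/funext => p; apply/funext => v; apply/funext => w.
rewrite /levi_civita; under eq_bigr do rewrite frmE.
apply: (riesz fB fBE t0 (phi := fun z => 2^-1 * koszul (S t) p v w z)) => z.
rewrite -(met_t_lc fB) /koszul metE !der_cst !(subrr, addr0, add0r).
by rewrite !lieE.
Qed.

Lemma bismutE : bismut (S t) = fun=> bis_t f B t.
Proof.
apply/funext => p; apply/funext => v; apply/funext => w.
rewrite /bismut levi_civitaE.
under eq_bigr do rewrite frmE.
rewrite (riesz fB fBE t0 (v := bis_t f B t v w - lc_t f B t v w)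
  (phi := fun z => 2^-1 * torsion (S t) p v w z)); first by rewrite addrC subrK.
by move=> z; rewrite torsionE (bis_lc fB).
Qed.

Lemma curv_bismut p v w z :
  curv (bismut (S t)) p v w z = (4 * t ^+ 2 * sigma f v w) *: rot f B z.
Proof. by rewrite bismutE curv_inv lieE (bis_curv fB fBE). Qed.

Lemma curv_levi_civita p v w z :
  curv (levi_civita (S t)) p v w z = lcR_t f B t v w z.
Proof. by rewrite levi_civitaE curv_inv lieE (lc_curv fB fBE). Qed.

Lemma met_tZ a v w : met_t f t (a *: v) w = a * met_t f t v w.
Proof. by rewrite /met_t /hdot !(fZ f); ring. Qed.

Lemma curvm_bismut p a c v w : curvm (S t) (bismut (S t)) p a c v w =
  4 * t ^+ 2 * sigma f v w * met_t f t (rot f B (frm_t B t a)) (frm_t B t c).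
Proof.
rewrite /curvm curv_bismut metE !frmE.
by rewrite met_tZ.
Qed.

Lemma curvm_levi_civita p a c v w : curvm (S t) (levi_civita (S t)) p a c v w =
  met_t f t (lcR_t f B t v w (frm_t B t a)) (frm_t B t c).
Proof. by rewrite /curvm curv_levi_civita metE !frmE. Qed.

(** Each curvature entry is a number times 4 t^2 sigma, so the sum of squares is
    16 t^4 sigma /\ sigma times half the squared norm of rot. *)
Lemma pont1_bismut p v0 v1 v2 v3 : pont1 (S t) (bismut (S t)) p v0 v1 v2 v3 =
  4 * t ^+ 4 / pi ^+ 2 * wedge22 (sigma f) (sigma f) v0 v1 v2 v3.
Proof.
rewrite /pont1.
have -> : \sum_(i < 6) \sum_(j < 6 | (i < j)%N)
    wedge22 (curvm (S t) (bismut (S t)) p j i)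
      (curvm (S t) (bismut (S t)) p j i) v0 v1 v2 v3 =
   \sum_(i < 6) \sum_(j < 6 | (i < j)%N)
   met_t f t (rot f B (frm_t B t j)) (frm_t B t i) *
   met_t f t (rot f B (frm_t B t j)) (frm_t B t i) *
    (16 * t ^+ 4 * wedge22 (sigma f) (sigma f) v0 v1 v2 v3).
  apply: eq_bigr => i _; apply: eq_bigr => j _.
  by rewrite /wedge22 !curvm_bismut; ring.
under eq_bigr do rewrite -mulr_suml.
rewrite -mulr_suml (rot_norm_pairs fB t0).
(* [field] would compute with the definition of pi; any nonzero q will do. *)
have := @pi_gt0 R; move: pi => q /gt_eqF/negbT q0.
by field.
Qed.

Lemma skew_curvm_bismut p a c v w :
  curvm (S t) (bismut (S t)) p a c v w = - curvm (S t) (bismut (S t)) p c a v w.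
Proof.
by rewrite !curvm_bismut (met_t_rot fB) (met_tC _ _ _ (rot _ _ _)) mulrN.
Qed.

Lemma skew_curvm_levi_civita p a c v w :
  curvm (S t) (levi_civita (S t)) p a c v w =
  - curvm (S t) (levi_civita (S t)) p c a v w.
Proof. by rewrite !curvm_levi_civita (met_t_lcR fB) met_tC. Qed.

(** Of the fifteen entries only the two mixing f^12 and f^34 have nonzero
    square. *)
Lemma pont1_levi_civita p v0 v1 v2 v3 :
  pont1 (S t) (levi_civita (S t)) p v0 v1 v2 v3 =
  3 * t ^+ 4 / (2 * pi ^+ 2) * wedge22 (sigma f) (sigma f) v0 v1 v2 v3.
Proof.
set ss := wedge22 (sigma f) (sigma f) v0 v1 v2 v3.
pose W k l v w := x k v * x l w - x k w * x l v.
pose r j i v w :=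
  met_t f t (lcR_t f B t v w (frm_t B t (ix j))) (frm_t B t (ix i)).
have CE j i : curvm (S t) (levi_civita (S t)) p (ix j) (ix i) = r j i.
  by apply/funext => v; apply/funext => w; exact: curvm_levi_civita.
(* The curvature entries are hidden behind the opaque Q, so that the fifteen
   squares can be selected by their indices alone. *)
have [Q QE] : exists Q : nat -> nat -> R,
    forall j i, wedge22 (r j i) (r j i) v0 v1 v2 v3 = Q j i by eexists.
have Q0 j i k l c : (forall v w, r j i v w = c * W k l v w) -> Q j i = 0.
  by move=> rE; rewrite -QE /wedge22 !rE /W; ring.
have Q2 j i a c : (forall v w, r j i v w = a * W 1 2 v w + c * W 3 4 v w) ->
    Q j i = - (a * c) * ss.
  by move=> rE; rewrite -QE /ss /wedge22 !rE /W /sigma; ring.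
have rE := lcR_frm fB t0.
rewrite /pont1 sum_pairs !CE !QE.
rewrite (Q2 2 1 (- 3 * t ^+ 2) (2 * t ^+ 2)) => [|v w]; last by rewrite /r rE.
rewrite (Q2 4 3 (2 * t ^+ 2) (- 3 * t ^+ 2)) => [|v w]; last by rewrite /r rE.
rewrite (Q0 3 1 2 4 (t ^+ 2)) => [|v w]; last by rewrite /r rE.
rewrite (Q0 4 1 2 3 (- t ^+ 2)) => [|v w]; last by rewrite /r rE.
rewrite (Q0 3 2 1 4 (- t ^+ 2)) => [|v w]; last by rewrite /r rE.
rewrite (Q0 4 2 1 3 (t ^+ 2)) => [|v w]; last by rewrite /r rE.
rewrite (Q0 6 1 1 6 (t ^+ 3)) => [|v w]; last by rewrite /r rE.
rewrite (Q0 6 2 2 6 (t ^+ 3)) => [|v w]; last by rewrite /r rE.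
rewrite (Q0 6 3 3 6 (t ^+ 3)) => [|v w]; last by rewrite /r rE.
rewrite (Q0 6 4 4 6 (t ^+ 3)) => [|v w]; last by rewrite /r rE.
have Q5 j i : (forall v w, r j i v w = 0) -> Q j i = 0.
  by move=> r0; apply: (Q0 j i 1 1 0) => v w; rewrite r0 mul0r.
rewrite (Q5 5 1) => [|v w]; last by rewrite /r rE.
rewrite (Q5 5 2) => [|v w]; last by rewrite /r rE.
rewrite (Q5 5 3) => [|v w]; last by rewrite /r rE.
rewrite (Q5 5 4) => [|v w]; last by rewrite /r rE.
rewrite (Q5 6 5) => [|v w]; last by rewrite /r rE.
have := @pi_gt0 R; move: pi => q /gt_eqF/negbT q0.
by field.
Qed.

Lemma trRR_pont1 (A : conn Gam) p v0 v1 v2 v3 :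
  (forall a c v w, curvm (S t) A p a c v w = - curvm (S t) A p c a v w) ->
  trRR (S t) A p v0 v1 v2 v3 = 16 * pi ^+ 2 * pont1 (S t) A p v0 v1 v2 v3.
Proof.
move=> skew; rewrite /trRR sum_sym => [|i|i j]; first last.
- by rewrite /wedge22 !(skew i j); ring.
- have C0 v w : curvm (S t) A p i i v w = 0.
    by apply/eqP; rewrite -eqNr -skew.
  by rewrite /wedge22 !C0; ring.
have sw i j : wedge22 (curvm (S t) A p i j) (curvm (S t) A p i j) v0 v1 v2 v3 =
    wedge22 (curvm (S t) A p j i) (curvm (S t) A p j i) v0 v1 v2 v3.
  by rewrite /wedge22 !(skew i j); ring.
rewrite /pont1; under eq_bigr do under eq_bigr do rewrite sw.
move: (\sum_(i < 6) _) => s.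
have := @pi_gt0 R; move: pi => q /gt_eqF/negbT q0.
by field.
Qed.

Lemma hermitian_structure_t : hermitian_structure (S t).
Proof.
split.
- split=> [p w|p v w|p v v0]; rewrite metE.
  + exact: met_t_scalar.
  + exact: met_tC.
  + exact: (met_t_gt0 fBE).
- split=> [p i j|p v]; rewrite metE ?frmE.
  + exact: (frm_t_orthonormal fB).
  + exact: (frm_t_expand fB fBE).
- split=> [p|p v|p v w]; rewrite ?/nijenhuis cplE.
  + exact: (cpl_t_linear fB fBE).
  + exact: (cpl_tK fB fBE).
  + rewrite !vbracket_inv !lieE (brk_cpl fB) (brk_cplr fB) (cpl_tN fB fBE).
    by rewrite opprK subrK subrr.
- by move=> p v w; rewrite metE cplE (met_t_cpl fB).
Qed.

Lemma kform_t0 v : kform_t f t 0 v = 0.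
Proof. by rewrite /kform_t !linear0; ring. Qed.

Lemma balanced_t : balanced (S t).
Proof.
move=> p v; rewrite /Defs.lee /codiff2 cplE kformE levi_civitaE.
set u := cpl_t f B t v.
pose E k := frm_t B t k.
rewrite (eq_bigr (fun k => - kform_t f t (E k) (lc_t f B t (E k) u))).
  by rewrite sumrN (kform_t_coclosed fB t0) !oppr0.
move=> k _; rewrite /nabla2 der_cst !frmE (lc_frm fB fBE) kform_t0; ring.
Qed.

Lemma hol_plus_su3_t : hol_plus_su3 (S t).
Proof.
move=> p v w; rewrite metE cplE.
under eq_bigr do rewrite curv_bismut frmE met_tZ.
by rewrite -mulr_sumr (rot_trace_cpl fB t0) mulr0.
Qed.

Lemma ricciE p v w : ricci (S t) p v w =
  - (2 * t ^+ 2) * hdot f v w + 4 * t ^+ 4 * (x 6 v * x 6 w).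
Proof.
rewrite /ricci metE; under eq_bigr do rewrite curv_levi_civita frmE.
exact: (ric_lc fB).
Qed.

Lemma torsion_coclosed p j k :
  \sum_i nabla3 (levi_civita (S t)) (torsion (S t)) p
    (frm (S t) i p) (frm (S t) i p) (frm (S t) j p) (frm (S t) k p) = 0.
Proof.
rewrite levi_civitaE torsionE.
set u := frm _ j p; set v := frm _ k p.
pose E k := frm_t B t k; pose D k := lc_t f B t (E k).
rewrite (eq_bigr (fun k =>
    - (tor_t f t (E k) (D k u) v + tor_t f t (E k) u (D k v)))).
  by rewrite sumrN (tor_t_coclosed fB t0) oppr0.
move=> i _; rewrite /nabla3 der_cst !frmE (lc_frm fB fBE).
rewrite {1}/tor_t /sigma !linear0; ring.
Qed.

End OneParameter.

(** Neither sigma nor rot depends on the parameter, so the conditions for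
    (J_t, g_t) hold for the connection of any other parameter. *)
Lemma instanton_bismut t t' : t != 0 -> t' != 0 ->
  instanton (S t) (bismut (S t')).
Proof.
move=> t0 t'0; split=> [p v w z|p z].
  by rewrite !curv_bismut// cplE (sigma_cpl fB).
rewrite cplE; under eq_bigr do rewrite curv_bismut// frmE.
by rewrite -scaler_suml -!mulr_sumr (sigma_trace_cpl fB) !mulr0 scale0r.
Qed.

(** The index m is traced in the frame of g_t, and a, c in that of g_t'; the two
    frames agree on the horizontal space, all that sigma and rot see. *)
Lemma gauge_stress t t' p v w : t != 0 -> t' != 0 ->
  \sum_m \sum_a \sum_c
     curvm (S t') (bismut (S t')) p a c v (frm (S t) m p) *
     curvm (S t') (bismut (S t')) p a c w (frm (S t) m p) =
  64 * t' ^+ 4 * hdot f v w.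
Proof.
move=> t0 t'0; rewrite -(sigma_sigma fB t) mulr_sumr; apply: eq_bigr => m _.
pose G a c := met_t f t' (rot f B (frm_t B t' a)) (frm_t B t' c).
transitivity (\sum_a \sum_c G a c * G a c *
    (16 * t' ^+ 4 * (sigma f v (frm_t B t m) * sigma f w (frm_t B t m)))).
  apply: eq_bigr => a _; apply: eq_bigr => c _; rewrite !curvm_bismut// frmE /G.
  by ring.
under eq_bigr do rewrite -mulr_suml.
by rewrite -mulr_suml (rot_norm fB t'0); ring.
Qed.

(** nabla^+_t' commutes with rot, so only nabla^+_t acting on the form factor
    sigma is left, and its divergence is zero. *)
Lemma instanton_coclosed t t' p j s : t != 0 -> t' != 0 ->
  \sum_i nabla_curv (bismut (S t)) (bismut (S t')) p (frm (S t) i p)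
    (frm (S t) i p) (frm (S t) j p) s = 0.
Proof.
move=> t0 t'0; set u := frm _ j p.
pose E k := frm_t B t k.
rewrite (eq_bigr (fun i =>
    - (4 * t' ^+ 2 * sigma f (E i) (bis_t f B t (E i) u)) *: rot f B s)).
  rewrite -scaler_suml sumrN -mulr_sumr (sigma_coclosed fB).
  by rewrite mulr0 oppr0 scale0r.
move=> i _; rewrite /nabla_curv.
have -> : (fun q => curv (bismut (S t')) q (frm (S t) i p) u s) =
    fun=> (4 * t' ^+ 2 * sigma f (frm (S t) i p) u) *: rot f B s.
  by apply/funext => q; rewrite curv_bismut.
rewrite bismutE// nabla_inv -bismutE// !curv_bismut// !bismutE// frmE.
rewrite (bis_rotZ fB fBE) (bis_frm fB fBE) subrr sub0r.
rewrite [sigma f 0 u]/sigma !linear0.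
by rewrite !(mul0r, mulr0, subrr, scale0r, oppr0) sub0r scaleNr.
Qed.

(** * Bianchi identity and equations of motion *)

(** Stated as an equivalence since the equations of motion are claimed for every
    alpha' that solves the Bianchi identity. *)
Lemma bianchi_bismutP t t' alpha : t != 0 -> t' != 0 ->
  bianchi (S t) (S t') (bismut (S t')) (bismut (S t)) alpha <->
  t ^+ 2 = 4 * alpha * (t ^+ 4 - t' ^+ 4).
Proof.
move=> t0 t'0; have := @pi_gt0 R => /gt_eqF/negbT pi0.
have E p v0 v1 v2 v3 : alpha / 4 *
      (trRR (S t) (bismut (S t)) p v0 v1 v2 v3
       - trRR (S t') (bismut (S t')) p v0 v1 v2 v3) =
    16 * alpha * (t ^+ 4 - t' ^+ 4) * wedge22 (sigma f) (sigma f) v0 v1 v2 v3.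
  rewrite !trRR_pont1; try exact: skew_curvm_bismut.
  by rewrite !pont1_bismut//; move: pi pi0 => q q0; field.
split=> [H|H p v0 v1 v2 v3]; last by rewrite ext_torsion// E H; ring.
have p : M3 Gam := (\pi_(nil5 Gam) 0, \pi_(circle R) 0)%qT.
have := H p (b 1) (b 2) (b 3) (b 4); rewrite ext_torsion// E.
by rewrite /wedge22 /sigma !(coB fB) //= => ?; lra.
Qed.

Lemma bianchi_levi_civita t t' alpha : t != 0 -> t' != 0 ->
  2 * t ^+ 2 = alpha * (3 * t ^+ 4 - 8 * t' ^+ 4) ->
  bianchi (S t) (S t') (bismut (S t')) (levi_civita (S t)) alpha.
Proof.
move=> t0 t'0 H p v0 v1 v2 v3; have := @pi_gt0 R => /gt_eqF/negbT pi0.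
rewrite ext_torsion// trRR_pont1; last exact: skew_curvm_levi_civita.
rewrite trRR_pont1; last exact: skew_curvm_bismut.
rewrite pont1_levi_civita// pont1_bismut//.
transitivity (2 * (alpha * (3 * t ^+ 4 - 8 * t' ^+ 4)) *
    wedge22 (sigma f) (sigma f) v0 v1 v2 v3); first by rewrite -H; ring.
by move: pi pi0 => q q0; field.
Qed.

(** The fibre part of Ric cancels against that of H^2 / 4; the horizontal part
    is a multiple of the relation on alpha'. *)
Lemma eom_bismut t t' alpha : t != 0 -> t' != 0 ->
  t ^+ 2 = 4 * alpha * (t ^+ 4 - t' ^+ 4) ->
  eom (S t) (S t') (bismut (S t')) (bismut (S t)) alpha.
Proof.
move=> t0 t'0 H; split=> [p i j|p j k|p j s].
- rewrite ricciE// !gauge_stress// torsionE// !frmE (tor_t_tor_t fB t0).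
  set hd := hdot f _ _.
  have -> : alpha / 4 * (64 * t' ^+ 4 * hd - 64 * t ^+ 4 * hd) =
    - (4 * (4 * alpha * (t ^+ 4 - t' ^+ 4)) * hd) by field.
  by rewrite -H; field.
- exact: torsion_coclosed.
- exact: instanton_coclosed.
Qed.

End Structures.

(** * The theorem *)

Theorem theorem5p1 (R : realType) (Gam : lattice R)
  (f : 'I_6 -> {scalar h3 R}) (B : 'I_6 -> h3 R)
  (hB : dual_frame f B) (hf : structure_eqs Gam f)
  (t t' : R) (ht : t != 0) (ht' : t' != 0) (htt' : t' != t) :
  let S := hstruct_t Gam f B t in
  let S' := hstruct_t Gam f B t' in
  let A := bismut S' in
  [/\ hermitian_structure S /\ balanced S,
      instanton S A,
      (3 * t ^+ 4 != 8 * t' ^+ 4 ->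
        forall p v0 v1 v2 v3, ext3 (torsion S) p v0 v1 v2 v3 =
          8 * pi ^+ 2 * t ^+ 2 / (3 * t ^+ 4 - 8 * t' ^+ 4) *
          (pont1 S (levi_civita S) p v0 v1 v2 v3 - pont1 S' A p v0 v1 v2 v3)) /\
      (t ^+ 4 != t' ^+ 4 ->
        forall p v0 v1 v2 v3, ext3 (torsion S) p v0 v1 v2 v3 =
          pi ^+ 2 * t ^+ 2 / (t ^+ 4 - t' ^+ 4) *
          (pont1 S (bismut S) p v0 v1 v2 v3 - pont1 S' A p v0 v1 v2 v3)),
      (8 * t' ^+ 4 < 3 * t ^+ 4 ->
        [/\ susy S A,
            exists p v w z, torsion S p v w z != 0,
            exists2 alpha : R, 0 < alpha & bianchi S S' A (levi_civita S) alpha &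
            exists2 alpha : R, 0 < alpha & bianchi S S' A (bismut S) alpha]) &
      (t ^+ 4 != t' ^+ 4 ->
        (exists alpha : R, bianchi S S' A (bismut S) alpha) /\
        (forall alpha : R, bianchi S S' A (bismut S) alpha ->
           eom S S' A (bismut S) alpha))].
Proof.
move=> S S' A.
have herm := hermitian_structure_t hB hf ht.
have bal := balanced_t hB hf ht.
have inst := instanton_bismut hB hf ht ht'.
have bianchiP := bianchi_bismutP hB hf _ ht ht'.
have t4 : 0 < t ^+ 4 by rewrite exprn_even_gt0.
have t'4 : 0 < t' ^+ 4 by rewrite exprn_even_gt0.
have t2 : 0 < t ^+ 2 by rewrite exprn_even_gt0.
have /gt_eqF/negbT pi0 := @pi_gt0 R.
have alphaE : t ^+ 4 != t' ^+ 4 ->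
    t ^+ 2 = 4 * (t ^+ 2 / (4 * (t ^+ 4 - t' ^+ 4))) * (t ^+ 4 - t' ^+ 4).
  by rewrite -subr_eq0 => d0; field.
split=> //.
- split; rewrite -subr_eq0 => d0 p v0 v1 v2 v3.
    rewrite (ext_torsion hB hf ht) (pont1_levi_civita hB hf ht).
    rewrite (pont1_bismut hB hf ht').
    by move: (pi : R) pi0 => q q0; field; rewrite q0 d0.
  rewrite (ext_torsion hB hf ht) !pont1_bismut//.
  by move: (pi : R) pi0 => q q0; field; rewrite q0 d0.
- move=> lt84; split.
  + by split=> //; exact: hol_plus_su3_t.
  + exists (\pi_(nil5 Gam) 0, \pi_(circle R) 0)%qT.
    exists (B (ix 1)), (B (ix 2)), (B (ix 6)).
    rewrite torsionE// /tor_t /sigma !(coB hB.1)//=.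
    rewrite !(mul0r, mulr0, mul1r, mulr1, add0r, addr0, subr0, sub0r, oppr0).
    by rewrite oppr_eq0 mulf_neq0// gt_eqF.
  + have d0 : 0 < 3 * t ^+ 4 - 8 * t' ^+ 4 by rewrite subr_gt0.
    exists (2 * t ^+ 2 / (3 * t ^+ 4 - 8 * t' ^+ 4)).
      by rewrite divr_gt0// mulr_gt0.
    by apply: bianchi_levi_civita => //; rewrite divfK// gt_eqF.
  + have d0 : 0 < t ^+ 4 - t' ^+ 4 by lra.
    exists (t ^+ 2 / (4 * (t ^+ 4 - t' ^+ 4))).
      by rewrite divr_gt0// mulr_gt0.
    by apply/bianchiP/alphaE; rewrite -subr_eq0 gt_eqF.
- move=> d0; split; first by eexists; apply/bianchiP/alphaE.
  by move=> alpha /bianchiP; exact: eom_bismut.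
Qed.
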